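(* Let $\mathbb{F}$ be a finite field with $|\mathbb{F}|=q$, let $\mathbb{E}/\mathbb{F}$ be a quadratic extension, let $c\in\mathbb{E}\setminus\{0\}$, and let $\mathrm{Tr}_c:\mathbb{E}\to\mathbb{F}$ be defined by $\mathrm{Tr}_c(x)=\mathrm{Tr}_{\mathbb{E}/\mathbb{F}}(cx)$ for every $x\in\mathbb{E}$. Put $s=\mathrm{Tr}_{\mathbb{E}/\mathbb{F}}(c)$ and $n=N_{\mathbb{E}/\mathbb{F}}(c)$. Regard $(\mathbb{E},\mathrm{Tr}_c)$ as a trace $\mathbb{F}$-algebra. Then $\mathrm{Id}(\mathbb{E},\mathrm{Tr}_c)$ follows from (that is, is equal to the T-ideal generated by) the following polynomials: (i) $t(x)t(y)-s\,t(xy)+n(x-x^q)(y-y^q)$; (ii) $t(1)-s$; (iii) $t(x)^q-t(x)$; (iv) $t(x)(1-x^{q^2-1})$; (v) $x^{q^2}-x$; (vi) all Capelli polynomials of order $3$.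
   Context: Algebras are associative over $\mathbb{F}$. A trace on an algebra $\mathcal{A}$ is an $\mathbb{F}$-linear map $t:\mathcal{A}\to\mathcal{A}$ such that for all $a,b$: $t(a)\in Z(\mathcal{A})$, $t(ab)=t(ba)$, $t(t(a)b)=t(a)t(b)$. A trace algebra is an algebra with a trace. $\mathrm{Tr}_{\mathbb{E}/\mathbb{F}}$ and $N_{\mathbb{E}/\mathbb{F}}$ are the usual field trace and norm. $\mathbb{F}\langle X,t\rangle$ denotes the free unital associative trace algebra freely generated by an infinite set $X$ of variables, i.e. the free algebra of the variety of unital associative algebras with a linear unary operation $t$ satisfying $t(x)y=yt(x)$, $t(xy)=t(yx)$, $t(t(x)y)=t(x)t(y)$ (here $t(1)$ is not assumed to be a scalar). A scalar in a polynomial stands for that multiple of $1$. For a unital trace algebra $(\mathcal{A},t)$, $\mathrm{Id}(\mathcal{A},t)\subseteq\mathbb{F}\langle X,t\rangle$ is the set of all trace polynomials vanishing under every substitution of the variables by elements of $\mathcal{A}$. A T-ideal is a two-sided ideal of $\mathbb{F}\langle X,t\rangle$ closed under $t$ and under all (trace-algebra) endomorphisms of $\mathbb{F}\langle X,t\rangle$; $\langle S\rangle$ is the smallest T-ideal containing $S$. ''$\mathrm{Id}(\mathcal{A},t)$ follows from $S$'' means $\mathrm{Id}(\mathcal{A},t)=\langle S\rangle$. A Capelli polynomial of order $m$ is a multilinear polynomial $f(x_1,\ldots,x_m,y_1,\ldots,y_r)\in\mathbb{F}\langle X,t\rangle$ that is alternating in $\{x_1,\ldots,x_m\}$. In the paper,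 each Capelli polynomial of order $m$ is a consequence of $[x,y]=xy-yx$ and the single polynomial $\sum_{\sigma\in\mathcal{S}_m}(-1)^\sigma t(y_1x_{\sigma(1)})\cdots t(y_{m-1}x_{\sigma(m-1)})y_mx_{\sigma(m)}$, where $(-1)^\sigma$ is the sign of $\sigma$. *)

(* Defs.v *)
From HB Require Import structures.
From mathcomp Require Import all_boot all_order all_algebra generic_quotient.
From mathcomp Require Import falgebra fieldext galois finfield.
From mathcomp Require Import boolp classical_sets cardinality.

Set Implicit Arguments.
Unset Strict Implicit.
Unset Printing Implicit Defensive.

Import GRing.Theory.
Local Open Scope ring_scope.
Local Open Scope quotient_scope.

Record trace (F : fieldType) (A : algType F) := Trace {
  trace_fun :> {linear A -> A};
  trace_central : forall a b, trace_fun a * b = b * trace_fun a;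
  trace_mulC : forall a b, trace_fun (a * b) = trace_fun (b * a);
  trace_tr : forall a b, trace_fun (trace_fun a * b) = trace_fun a * trace_fun b
}.

(* The free unital trace algebra on X is the algebra of terms in the unital   *)
(* trace algebra operations, modulo the congruence generated by the axioms.   *)
Inductive term (F X : Type) :=
  | TVar of X
  | TZero
  | TOne
  | TAdd of term F X & term F X
  | TMul of term F X & term F X
  | TScale of F & term F X
  | TTr of term F X.
Arguments TVar F {X}.
Arguments TZero {F X}.
Arguments TOne {F X}.

HB.instance Definition _ (F X : Type) := gen_eqMixin (term F X).
HB.instance Definition _ (F X : Type) := gen_choiceMixin (term F X).

Section FreeTraceAlgebra.
Variables (F : fieldType) (X : Type).
Local Notation T := (term F X).
Implicit Types (u v w : T) (a b : F).

Inductive teq : T -> T -> Prop :=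
  | teq_refl u : teq u u
  | teq_sym u v : teq u v -> teq v u
  | teq_trans u v w : teq u v -> teq v w -> teq u w
  | teq_add u u' v v' : teq u u' -> teq v v' -> teq (TAdd u v) (TAdd u' v')
  | teq_mul u u' v v' : teq u u' -> teq v v' -> teq (TMul u v) (TMul u' v')
  | teq_scale a u u' : teq u u' -> teq (TScale a u) (TScale a u')
  | teq_tr u u' : teq u u' -> teq (TTr u) (TTr u')
  | teq_addA u v w : teq (TAdd u (TAdd v w)) (TAdd (TAdd u v) w)
  | teq_addC u v : teq (TAdd u v) (TAdd v u)
  | teq_add0 u : teq (TAdd TZero u) u
  | teq_scale0 u : teq (TScale 0 u) TZero
  | teq_scale1 u : teq (TScale 1 u) u
  | teq_scaleA a b u : teq (TScale a (TScale b u)) (TScale (a * b) u)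
  | teq_scaleDr a u v :
      teq (TScale a (TAdd u v)) (TAdd (TScale a u) (TScale a v))
  | teq_scaleDl a b u :
      teq (TScale (a + b) u) (TAdd (TScale a u) (TScale b u))
  | teq_mulA u v w : teq (TMul u (TMul v w)) (TMul (TMul u v) w)
  | teq_mul1l u : teq (TMul TOne u) u
  | teq_mul1r u : teq (TMul u TOne) u
  | teq_mulDl u v w : teq (TMul (TAdd u v) w) (TAdd (TMul u w) (TMul v w))
  | teq_mulDr u v w : teq (TMul u (TAdd v w)) (TAdd (TMul u v) (TMul u w))
  | teq_scaleAl a u v : teq (TScale a (TMul u v)) (TMul (TScale a u) v)
  | teq_scaleAr a u v : teq (TScale a (TMul u v)) (TMul u (TScale a v))
  | teq_trD u v : teq (TTr (TAdd u v)) (TAdd (TTr u) (TTr v))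
  | teq_trZ a u : teq (TTr (TScale a u)) (TScale a (TTr u))
  | teq_tr_central u v : teq (TMul (TTr u) v) (TMul v (TTr u))
  | teq_tr_mulC u v : teq (TTr (TMul u v)) (TTr (TMul v u))
  | teq_tr_tr u v : teq (TTr (TMul (TTr u) v)) (TMul (TTr u) (TTr v)).

Definition teqb : rel T := fun u v => `[< teq u v >].

Lemma teqb_equiv : equiv_class_of teqb.
Proof.
split=> [u | u v | v u w /asboolP uv /asboolP vw].
- exact/asboolP/teq_refl.
- by apply/asboolP/asboolP => /teq_sym.
- exact/asboolP/(teq_trans uv).
Qed.

Canonical teqb_equiv_rel := EquivRelPack teqb_equiv.

Definition freeTr := {eq_quot teqb}.
HB.instance Definition _ := Choice.on freeTr.
HB.instance Definition _ := Quotient.on freeTr.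

Implicit Types f g h : freeTr.

Lemma piP u v : reflect (\pi_freeTr u = \pi_freeTr v) `[< teq u v >].
Proof. exact: (@eqmodP T teqb_equiv_rel). Qed.

Lemma teq_repr u : teq (repr (\pi_freeTr u)) u.
Proof. by apply/asboolP/piP; rewrite reprK. Qed.

Lemma pi_eq u f : teq u (repr f) -> \pi_freeTr u = f.
Proof. by move=> uf; rewrite -[f]reprK; apply/piP/asboolP. Qed.

Lemma pi_teq u v : teq u v -> \pi_freeTr u = \pi_freeTr v.
Proof. by move=> uv; apply/piP/asboolP. Qed.

Definition fvar (x : X) : freeTr := \pi_freeTr (TVar F x).
Definition fzero : freeTr := \pi_freeTr TZero.
Definition fone : freeTr := \pi_freeTr TOne.
Definition fadd f g : freeTr := \pi_freeTr (TAdd (repr f) (repr g)).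
Definition fmul f g : freeTr := \pi_freeTr (TMul (repr f) (repr g)).
Definition fscale a f : freeTr := \pi_freeTr (TScale a (repr f)).
Definition ftr f : freeTr := \pi_freeTr (TTr (repr f)).

Lemma faddE u v : fadd (\pi_freeTr u) (\pi_freeTr v) = \pi_freeTr (TAdd u v).
Proof. by apply: pi_teq; apply: teq_add; apply: teq_repr. Qed.
Lemma fmulE u v : fmul (\pi_freeTr u) (\pi_freeTr v) = \pi_freeTr (TMul u v).
Proof. by apply: pi_teq; apply: teq_mul; apply: teq_repr. Qed.
Lemma fscaleE a u : fscale a (\pi_freeTr u) = \pi_freeTr (TScale a u).
Proof. by apply: pi_teq; apply: teq_scale; apply: teq_repr. Qed.
Lemma ftrE u : ftr (\pi_freeTr u) = \pi_freeTr (TTr u).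
Proof. by apply: pi_teq; apply: teq_tr; apply: teq_repr. Qed.

Lemma piK f : {u | f = \pi_freeTr u}.
Proof. by exists (repr f); rewrite reprK. Qed.

Lemma faddA : associative fadd.
Proof.
move=> f g h; case: (piK f) (piK g) (piK h) => u -> [v ->] [w ->].
by rewrite !faddE; apply/pi_teq/teq_addA.
Qed.
Lemma faddC : commutative fadd.
Proof.
move=> f g; case: (piK f) (piK g) => u -> [v ->].
by rewrite !faddE; apply/pi_teq/teq_addC.
Qed.
Lemma fadd0 : left_id fzero fadd.
Proof. by move=> f; case: (piK f) => u ->; rewrite faddE; apply/pi_teq/teq_add0. Qed.
Lemma faddN : left_inverse fzero (fscale (-1)) fadd.
Proof.
move=> f; case: (piK f) => u ->; rewrite fscaleE faddE; apply/pi_teq.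
apply: (teq_trans _ (teq_scale0 u)); rewrite -(addNr 1).
apply: (teq_trans _ (teq_sym (teq_scaleDl _ _ u))).
by apply: teq_add (teq_refl _) (teq_sym (teq_scale1 u)).
Qed.
HB.instance Definition _ := GRing.isZmodule.Build freeTr faddA faddC fadd0 faddN.

Lemma fmulA : associative fmul.
Proof.
move=> f g h; case: (piK f) (piK g) (piK h) => u -> [v ->] [w ->].
by rewrite !fmulE; apply/pi_teq/teq_mulA.
Qed.
Lemma fmul1l : left_id fone fmul.
Proof. by move=> f; case: (piK f) => u ->; rewrite fmulE; apply/pi_teq/teq_mul1l. Qed.
Lemma fmul1r : right_id fone fmul.
Proof. by move=> f; case: (piK f) => u ->; rewrite fmulE; apply/pi_teq/teq_mul1r. Qed.
Lemma fmulDl : left_distributive fmul +%R.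
Proof.
move=> f g h; case: (piK f) (piK g) (piK h) => u -> [v ->] [w ->].
by rewrite /GRing.add /= !(faddE, fmulE); apply/pi_teq/teq_mulDl.
Qed.
Lemma fmulDr : right_distributive fmul +%R.
Proof.
move=> f g h; case: (piK f) (piK g) (piK h) => u -> [v ->] [w ->].
by rewrite /GRing.add /= !(faddE, fmulE); apply/pi_teq/teq_mulDr.
Qed.

Section TermEvaluation.
Variables (A : algType F) (t : trace A) (rho : X -> A).

Fixpoint tm_eval (u : T) : A :=
  match u with
  | TVar x => rho x
  | TZero => 0
  | TOne => 1
  | TAdd u v => tm_eval u + tm_eval v
  | TMul u v => tm_eval u * tm_eval v
  | TScale a u => a *: tm_eval u
  | TTr u => t (tm_eval u)
  end.

Lemma tm_eval_teq u v : teq u v -> tm_eval u = tm_eval v.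
Proof.
elim=> {u v} //=.
- by move=> u v w _ -> _ ->.
- by move=> u u' v v' _ -> _ ->.
- by move=> u u' v v' _ -> _ ->.
- by move=> a u u' _ ->.
- by move=> u u' _ ->.
- by move=> u v w; rewrite addrA.
- by move=> u v; rewrite addrC.
- by move=> u; rewrite add0r.
- by move=> u; rewrite scale0r.
- by move=> u; rewrite scale1r.
- by move=> a b u; rewrite scalerA.
- by move=> a u v; rewrite scalerDr.
- by move=> a b u; rewrite scalerDl.
- by move=> u v w; rewrite mulrA.
- by move=> u; rewrite mul1r.
- by move=> u; rewrite mulr1.
- by move=> u v w; rewrite mulrDl.
- by move=> u v w; rewrite mulrDr.
- by move=> a u v; rewrite scalerAl.
- by move=> a u v; rewrite scalerAr.
- by move=> u v; rewrite linearD.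
- by move=> a u; rewrite linearZ.
- by move=> u v; apply: trace_central.
- by move=> u v; apply: trace_mulC.
- by move=> u v; apply: trace_tr.
Qed.

End TermEvaluation.

Lemma fone_neq0 : fone != 0.
Proof.
have idC a b : (idfun : {linear F^o -> F^o}) a * b = b * a by apply: mulrC.
pose t : trace F^o := @Trace F F^o idfun idC (@mulrC _) (fun _ _ => erefl).
apply/eqP => /piP/asboolP/(tm_eval_teq t (fun=> 0)) /= /eqP.
by rewrite oner_eq0.
Qed.
HB.instance Definition _ := GRing.Zmodule_isNzRing.Build freeTr
  fmulA fmul1l fmul1r fmulDl fmulDr fone_neq0.

Lemma fscaleA a b f : fscale a (fscale b f) = fscale (a * b) f.
Proof. by case: (piK f) => u ->; rewrite !fscaleE; apply/pi_teq/teq_scaleA. Qed.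
Lemma fscale1 : left_id 1 fscale.
Proof. by move=> f; case: (piK f) => u ->; rewrite fscaleE; apply/pi_teq/teq_scale1. Qed.
Lemma fscaleDr : right_distributive fscale +%R.
Proof.
move=> a f g; case: (piK f) (piK g) => u -> [v ->].
by rewrite /GRing.add /= !(faddE, fscaleE); apply/pi_teq/teq_scaleDr.
Qed.
Lemma fscaleDl f : {morph fscale^~ f : a b / a + b}.
Proof.
move=> a b; case: (piK f) => u ->.
by rewrite [RHS]/GRing.add /= !(faddE, fscaleE); apply/pi_teq/teq_scaleDl.
Qed.
HB.instance Definition _ := GRing.Zmodule_isLmodule.Build F freeTr
  fscaleA fscale1 fscaleDr fscaleDl.

Lemma fscaleAl a f g : a *: (f * g) = a *: f * g.
Proof.
case: (piK f) (piK g) => u -> [v ->].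
rewrite /GRing.scale /GRing.mul /= !(fmulE, fscaleE).
exact/pi_teq/teq_scaleAl.
Qed.
HB.instance Definition _ := GRing.Lmodule_isLalgebra.Build F freeTr fscaleAl.

Lemma fscaleAr a f g : a *: (f * g) = f * (a *: g).
Proof.
case: (piK f) (piK g) => u -> [v ->].
rewrite /GRing.scale /GRing.mul /= !(fmulE, fscaleE).
exact/pi_teq/teq_scaleAr.
Qed.
HB.instance Definition _ := GRing.Lalgebra_isAlgebra.Build F freeTr fscaleAr.

Lemma ftr_is_linear : linear ftr.
Proof.
move=> a f g; case: (piK f) (piK g) => u -> [v ->].
rewrite /GRing.scale /GRing.add /= !(fscaleE, faddE, ftrE).
apply/pi_teq; apply: (teq_trans (teq_trD _ _)).
exact: teq_add (teq_trZ _ _) (teq_refl _).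
Qed.
HB.instance Definition _ := GRing.isLinear.Build F freeTr freeTr _ ftr ftr_is_linear.

Lemma ftr_central f g : ftr f * g = g * ftr f.
Proof.
case: (piK f) (piK g) => u -> [v ->].
by rewrite /GRing.mul /= !(ftrE, fmulE); apply/pi_teq/teq_tr_central.
Qed.
Lemma ftr_mulC f g : ftr (f * g) = ftr (g * f).
Proof.
case: (piK f) (piK g) => u -> [v ->].
by rewrite /GRing.mul /= !(ftrE, fmulE); apply/pi_teq/teq_tr_mulC.
Qed.
Lemma ftr_tr f g : ftr (ftr f * g) = ftr f * ftr g.
Proof.
case: (piK f) (piK g) => u -> [v ->].
by rewrite /GRing.mul /= !(ftrE, fmulE); apply/pi_teq/teq_tr_tr.
Qed.

Definition free_trace : trace freeTr := Trace ftr_central ftr_mulC ftr_tr.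

Definition teval (A : algType F) (t : trace A) (rho : X -> A) f : A :=
  tm_eval t rho (repr f).

Section Evaluation.
Variables (A : algType F) (t : trace A) (rho : X -> A).
Local Notation ev := (teval t rho).

Lemma teval_pi u : ev (\pi_freeTr u) = tm_eval t rho u.
Proof. by apply: tm_eval_teq; apply: teq_repr. Qed.

Lemma teval_is_linear : linear ev.
Proof.
move=> a f g; case: (piK f) (piK g) => u -> [v ->].
rewrite [in LHS]/GRing.scale [in LHS]/GRing.add /= fscaleE faddE.
by rewrite !teval_pi.
Qed.
HB.instance Definition _ := GRing.isLinear.Build F freeTr A _ ev teval_is_linear.

Lemma teval_is_monoid_morphism : monoid_morphism ev.
Proof.
split=> [|f g]; first by rewrite {1}/GRing.one /= teval_pi.
case: (piK f) (piK g) => u -> [v ->].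
by rewrite [in LHS]/GRing.mul /= fmulE !teval_pi.
Qed.
HB.instance Definition _ := GRing.isMonoidMorphism.Build freeTr A ev
  teval_is_monoid_morphism.

Lemma teval_var x : ev (fvar x) = rho x.
Proof. exact: teval_pi. Qed.

Lemma teval_tr f : ev (ftr f) = t (ev f).
Proof. by case: (piK f) => u ->; rewrite ftrE !teval_pi. Qed.

Lemma teval_unique (phi : {lrmorphism freeTr -> A}) :
    (forall f, phi (ftr f) = t (phi f)) -> (forall x, phi (fvar x) = rho x) ->
  phi =1 ev.
Proof.
move=> phi_tr phi_var f; case: (piK f) => u ->; rewrite teval_pi.
elim: u => /= [x | | |u IHu v IHv|u IHu v IHv|a u IHu|u IHu].
- exact: phi_var.
- exact: (rmorph0 phi).
- exact: (rmorph1 phi).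
- rewrite -faddE -IHu -IHv.
  exact: (rmorphD phi (\pi_freeTr u) (\pi_freeTr v)).
- rewrite -fmulE -IHu -IHv.
  exact: (rmorphM phi (\pi_freeTr u) (\pi_freeTr v)).
- rewrite -fscaleE -IHu.
  exact: (linearZ_LR phi a (\pi_freeTr u)).
- by rewrite -ftrE phi_tr IHu.
Qed.

End Evaluation.
End FreeTraceAlgebra.

Arguments fvar F {X}.
Arguments ftr {F X}.

Local Open Scope classical_set_scope.

Definition trId (F : fieldType) (X : Type) (A : algType F) (t : trace A) :
    set (freeTr F X) :=
  [set f | forall rho : X -> A, teval t rho f = 0].

Record T_ideal (F : fieldType) (X : Type) (I : set (freeTr F X)) : Prop := {
  T_ideal0 : I 0;
  T_idealD : forall f g, I f -> I g -> I (f + g);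
  T_idealMl : forall f g, I g -> I (f * g);
  T_idealMr : forall f g, I f -> I (f * g);
  T_ideal_tr : forall f, I f -> I (ftr f);
  T_ideal_endo : forall phi : {lrmorphism freeTr F X -> freeTr F X},
    (forall f, phi (ftr f) = ftr (phi f)) -> forall f, I f -> I (phi f)
}.

Definition T_ideal_gen (F : fieldType) (X : Type) (S : set (freeTr F X)) :
    set (freeTr F X) :=
  smallest (@T_ideal F X) S.

Section Capelli.
Variables (F : fieldType) (X : eqType).
Local Notation FXt := (freeTr F X).

(* [monomial w f]: f is a trace monomial whose variables, listed with         *)
(* multiplicity, are w.                                                       *)
Inductive monomial : seq X -> FXt -> Prop :=
  | monomial1 : monomial [::] 1
  | monomial_var x : monomial [:: x] (fvar F x)
  | monomialM v w f g : monomial v f -> monomial w g -> monomial (v ++ w) (f * g)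
  | monomial_tr w f : monomial w f -> monomial w (ftr f).

Definition multilinear (vs : seq X) (f : FXt) : Prop :=
  exists (k : nat) (a : 'I_k -> F) (m : 'I_k -> FXt),
    (forall i, exists2 w, monomial w (m i) & perm_eq w vs) /\
    f = \sum_(i < k) a i *: m i.

(* Vanishing on equal arguments, rather than a sign rule: the latter is       *)
(* strictly weaker in characteristic 2, where t(x)t(y) would satisfy it.      *)
Definition alternating (m : nat) (xs : m.-tuple X) (f : FXt) : Prop :=
  forall i j : 'I_m, i != j ->
    teval (free_trace F X)
      (fun z => fvar F (if z == tnth xs j then tnth xs i else z)) f = 0.

Definition capelli (m : nat) : set FXt :=
  [set f | exists (xs : m.-tuple X) (ys : seq X),
     [/\ uniq (xs ++ ys), multilinear (xs ++ ys) f & alternating xs f]].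

End Capelli.

Section QuadraticTrace.
Variables (F : finFieldType) (E : fieldExtType F).
Implicit Types c x : E.

(* [finvect_type E] is E itself, equipped with its structure of splitting     *)
(* field (any finite extension of a finite field is Galois). Both functions   *)
(* take their values in the image 1%VS of F in E.                             *)
Definition field_tr x : E := galTrace 1 {:finvect_type E} x.
Definition field_norm x : E := galNorm 1 {:finvect_type E} x.

Lemma field_tr_in x : field_tr x \in 1%VS.
Proof.
apply: (@mem_galTrace F (finvect_type E) 1%AS {:finvect_type E}%AS x).
  exact: finField_galois (sub1v _).
exact: memvf.
Qed.

Definition Trc c x : E := field_tr (c * x).

Lemma Trc_is_linear c : linear (Trc c).
Proof.
move=> a x y; rewrite /Trc /field_tr /galTrace mulrDr -scalerAr.
rewrite scaler_sumr -big_split; apply: eq_bigr => g _ /=.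
exact: linearP.
Qed.
HB.instance Definition _ c := GRing.isLinear.Build F E E _ (Trc c) (Trc_is_linear c).

Lemma Trc_central c x y : Trc c x * y = y * Trc c x.
Proof. exact: mulrC. Qed.
Lemma Trc_mulC c x y : Trc c (x * y) = Trc c (y * x).
Proof. by rewrite mulrC. Qed.
Lemma Trc_tr c x y : Trc c (Trc c x * y) = Trc c x * Trc c y.
Proof.
have /vlineP[a Da] : Trc c x \in 1%VS := field_tr_in (c * x).
by rewrite Da !mulr_algl linearZ.
Qed.

Definition Trc_trace c : trace E :=
  @Trace F E (Trc c) (Trc_central c) (Trc_mulC c) (Trc_tr c).

End QuadraticTrace.

(* Main.v *)
Require Import Defs.
From HB Require Import structures.
From mathcomp Require Import all_boot all_order all_algebra.
From mathcomp Require Import fingroup generic_quotient.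
From mathcomp Require Import falgebra fieldext galois finfield.
From mathcomp Require Import ring.
From mathcomp Require Import boolp classical_sets cardinality.

Set Implicit Arguments.
Unset Strict Implicit.
Unset Printing Implicit Defensive.

Import GRing.Theory.
Local Open Scope ring_scope.
Local Open Scope classical_set_scope.

(** Write q for the cardinal of F, Tr for the trace x |-> Tr_(E/F)(c x) and
    C = c^q for the conjugate of c, so that Tr(u) = c u + C u^q, s = c + C and
    n = c C. The listed polynomials vanish on (E, Tr) by direct computation,
    and the Capelli polynomials do because they are multilinear and alternating
    in three arguments while E has dimension 2 ([capelli_identity]); moreover
    the identities of any trace algebra form a T-ideal ([trId_T_ideal]).

    For the converse, let I be a T-ideal that contains the generators, and let
    f be an element outside I. It is enough to find an evaluation in (E, Tr) at
    which f does not vanish. The standard polynomial of degree 3 is a Capelli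
    polynomial, and its value at (1, u, v) is u v - v u; hence the free trace
    algebra is commutative modulo I ([T_ideal_commutator]). Since
    u^(q^2) = u modulo I, the quotient is a commutative von Neumann regular
    ring, in which the nonzero class of f survives in some residue field K
    ([separating_field_ideal]). The identity t(u) (1 - u^(q^2 - 1)) says that
    t(u) is a multiple of u, so every ideal is stable under t and K
    inherits a trace.

    It remains to see that this trace algebra K embeds in (E, Tr)
    ([field_quotient_vanish]). Elements of K fixed by the q-th power lie in F.
    If there are no others, then K = F with t(1) = s, which sits in E as the
    scalars. Otherwise pick g with g^q <> g. Then K = F + F g, the element g
    is a root of X^2 - (g + g^q) X + g^(q+1), which has coefficients in F and
    divides X^(q^2) - X, hence has a root e in E ([conjugates_in_extension]).
    The first identity at x = y = g is a quadratic equation over F for t(g),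
    and the roots of this equation are Tr(e) and Tr(e^q)
    ([traced_conjugate]). After replacing e by e^q if necessary, t(g) = Tr(e),
    and a + b g |-> a + b e is an embedding of trace algebras. As f vanishes
    in (E, Tr), its image in K is zero: a contradiction. *)

(** * Residue fields of possibly noncommutative rings *)

Record two_sided_ideal (R : nzRingType) (J : set R) : Prop := TwoSidedIdeal {
  ideal0 : J 0;
  idealD : forall a b, J a -> J b -> J (a + b);
  idealMl : forall a b, J b -> J (a * b);
  idealMr : forall a b, J a -> J (a * b)
}.

Section IdealTheory.
Variables (R : nzRingType) (J : set R).
Hypothesis idJ : two_sided_ideal J.

Lemma idealN a : J a -> J (- a).
Proof. by rewrite -mulN1r; apply: idealMl. Qed.

Lemma ideal_mod a b : J (a - b) -> J b -> J a.
Proof. by move=> Jab Jb; rewrite -(subrK b a); apply: idealD. Qed.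

End IdealTheory.

(** Containing the commutators is what allows a quotient of a noncommutative ring
    to be a field; the axioms are bundled so that the field structure on
    [residue M] can be inferred from M alone. *)
Record field_ideal (R : nzRingType) := FieldIdeal {
  field_ideal_set :> R -> Prop;
  field_idealP : two_sided_ideal field_ideal_set;
  field_ideal1 : ~ field_ideal_set 1;
  field_ideal_comm : forall a b, field_ideal_set (a * b - b * a);
  field_ideal_inv : forall a, ~ field_ideal_set a ->
    exists b, field_ideal_set (b * a - 1)
}.

Section ResidueField.
Local Open Scope quotient_scope.
Variables (R : nzRingType) (M : field_ideal R).
Let idM := field_idealP M.

Definition eqmod : rel R := fun a b => `[< M (a - b) >].

Lemma eqmod_equiv : equiv_class_of eqmod.
Proof.
split=> [a | a b | b a d /asboolP ab /asboolP bd].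
- by apply/asboolP; rewrite subrr; apply: ideal0 idM.
- by apply/asboolP/asboolP => /(idealN idM); rewrite opprB.
- by apply/asboolP; rewrite -(subrKA b); apply: idealD.
Qed.

Canonical eqmod_equiv_rel := EquivRelPack eqmod_equiv.

Definition residue := {eq_quot eqmod}.
HB.instance Definition _ := Choice.on residue.
HB.instance Definition _ := Quotient.on residue.

Local Notation res := (\pi_residue).

Lemma resP a b : res a = res b <-> M (a - b).
Proof.
split=> [/eqmodP /asboolP //|Mab].
by apply/eqmodP/asboolP.
Qed.

Lemma res_repr a : M (repr (res a) - a).
Proof. by apply/resP; rewrite reprK. Qed.

Lemma resK (x : residue) : {a | x = res a}.
Proof. by exists (repr x); rewrite reprK. Qed.

Definition res_add (x y : residue) : residue := res (repr x + repr y).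
Definition res_opp (x : residue) : residue := res (- repr x).
Definition res_mul (x y : residue) : residue := res (repr x * repr y).

Lemma res_addE a b : res_add (res a) (res b) = res (a + b).
Proof.
apply/resP; rewrite opprD addrACA.
by apply: (idealD idM); apply: res_repr.
Qed.

Lemma res_oppE a : res_opp (res a) = res (- a).
Proof. by apply/resP; rewrite -opprD; apply/(idealN idM)/res_repr. Qed.

Lemma res_mulE a b : res_mul (res a) (res b) = res (a * b).
Proof.
apply/resP; rewrite -(subrKA (repr (res a) * b)) -mulrBr -mulrBl.
apply: (idealD idM); first exact/(idealMl idM)/res_repr.
exact/(idealMr idM)/res_repr.
Qed.

Lemma res_addA : associative res_add.
Proof.
move=> x y z; case: (resK x) (resK y) (resK z) => a -> [b ->] [d ->].
by rewrite !res_addE addrA.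
Qed.
Lemma res_addC : commutative res_add.
Proof. by move=> x y; rewrite /res_add addrC. Qed.
Lemma res_add0 : left_id (res 0) res_add.
Proof. by move=> x; case: (resK x) => a ->; rewrite res_addE add0r. Qed.
Lemma res_addN : left_inverse (res 0) res_opp res_add.
Proof. by move=> x; case: (resK x) => a ->; rewrite res_oppE res_addE addNr. Qed.
HB.instance Definition _ :=
  GRing.isZmodule.Build residue res_addA res_addC res_add0 res_addN.

Lemma res_mulA : associative res_mul.
Proof.
move=> x y z; case: (resK x) (resK y) (resK z) => a -> [b ->] [d ->].
by rewrite !res_mulE mulrA.
Qed.
Lemma res_mulC : commutative res_mul.
Proof. by move=> x y; apply/resP/field_ideal_comm. Qed.
Lemma res_mul1 : left_id (res 1) res_mul.
Proof. by move=> x; case: (resK x) => a ->; rewrite res_mulE mul1r. Qed.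
Lemma res_mulDl : left_distributive res_mul +%R.
Proof.
move=> x y z; case: (resK x) (resK y) (resK z) => a -> [b ->] [d ->].
by rewrite /GRing.add /= !(res_addE, res_mulE) mulrDl.
Qed.
Lemma res1_neq0 : res 1 != 0.
Proof. by apply/eqP => /resP; rewrite subr0; apply: field_ideal1. Qed.
HB.instance Definition _ := GRing.Zmodule_isComNzRing.Build residue
  res_mulA res_mulC res_mul1 res_mulDl res1_neq0.

Definition res_inv (x : residue) : residue :=
  if x == 0 then 0 else xget 0 [set y | y * x = 1].

Lemma res_mulV x : x != 0 -> res_inv x * x = 1.
Proof.
rewrite /res_inv => x0; rewrite (negPf x0); case: xgetP => // noinv.
case: (resK x) => a Dx; have [|b Mba] := @field_ideal_inv _ M a.
  by move=> Ma; case/eqP: x0; rewrite Dx; apply/resP; rewrite subr0.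
case: (noinv (res b)); rewrite /= Dx {1}/GRing.mul /= res_mulE.
exact/resP.
Qed.
Lemma res_inv0 : res_inv 0 = 0.
Proof. by rewrite /res_inv eqxx. Qed.
HB.instance Definition _ := GRing.ComNzRing_isField.Build residue res_mulV res_inv0.

Definition residue_map (a : R) : residue := res a.

Lemma residue_map_is_zmod_morphism : zmod_morphism residue_map.
Proof.
move=> a b; rewrite /residue_map [in RHS]/GRing.add /= [in RHS]/GRing.opp /=.
by rewrite res_oppE res_addE.
Qed.
Lemma residue_map_is_monoid_morphism : monoid_morphism residue_map.
Proof. by split=> // a b; rewrite [in RHS]/GRing.mul /= res_mulE. Qed.
HB.instance Definition _ :=
  GRing.isZmodMorphism.Build R residue residue_map residue_map_is_zmod_morphism.
HB.instance Definition _ :=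
  GRing.isMonoidMorphism.Build R residue residue_map residue_map_is_monoid_morphism.

Lemma residue_map_eq0 a : residue_map a = 0 <-> M a.
Proof.
split; first by move/resP; rewrite subr0.
by move=> Ma; apply/resP; rewrite subr0.
Qed.

End ResidueField.

Section Separation.
Variables (R : nzRingType) (I : set R) (N : nat).
Hypothesis idI : two_sided_ideal I.
Hypothesis I_comm : forall a b, I (a * b - b * a).
Hypothesis I_pow : forall a, I (a ^+ N.+2 - a).

(** The sum of M and the principal ideal of a: modulo M the ring is commutative,
    so the left multiples of a already form a two-sided ideal. *)
Lemma adjoin_ideal (M : set R) (a : R) : two_sided_ideal M ->
    (forall b d, M (b * d - d * b)) ->
  two_sided_ideal [set x | exists r, M (x - r * a)].
Proof.
move=> idM M_comm; split=> /=.
- by exists 0; rewrite mul0r subr0; apply: ideal0.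
- move=> x y [r Mx] [r' My]; exists (r + r').
  by rewrite mulrDl opprD addrACA; apply: idealD.
- by move=> x y [r My]; exists (x * r); rewrite -mulrA -mulrBr; apply: idealMl.
- move=> x y [r Mx]; exists (r * y).
  rewrite -(subrKA (r * a * y)) -mulrBl -!mulrA -mulrBr.
  by apply: idealD => //; [apply: idealMr | apply: idealMl].
Qed.

(** An ideal M maximal among those that contain I and avoid f is a field ideal.
    Put u = 1 - f^(N+1), which satisfies u f = 0 modulo I. If u were outside M,
    maximality would give f = r u modulo M, whence f^2 = 0 and f = f^(N+2) = 0.
    So f is invertible modulo M, and every a outside M divides f modulo M, again
    by maximality. *)
Lemma separating_field_ideal f : ~ I f ->
  exists2 M : field_ideal R, I `<=` field_ideal_set M & ~ M f.
Proof.
move=> If.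
(* The union with I makes the empty chain harmless: it yields I itself. *)
pose P J := two_sided_ideal (I `|` J) /\ ~ (I `|` J) f.
have [|M0 [[idM Mf] maxM]] := @Zorn_bigcup _ P.
  move=> C CP Ctot; split; last first.
    by case=> // -[J CJ Jf]; case: (CP J CJ) => _; apply; right.
  have lub x y : (I `|` \bigcup_(J in C) J) x -> (I `|` \bigcup_(J in C) J) y ->
      (I x /\ I y) \/ exists J, [/\ C J, (I `|` J) x & (I `|` J) y].
    case=> [Ix|[J CJ Jx]] [Iy|[J' CJ' Jy]]; first by left.
    - by right; exists J'; split; [|left|right].
    - by right; exists J; split; [|right|left].
    - right; have [JJ|JJ] := Ctot J J' CJ CJ'.
        by exists J'; split=> //; right; first exact: JJ.
      by exists J; split=> //; right; last exact: JJ.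
  have sub J : C J -> I `|` J `<=` I `|` \bigcup_(J in C) J.
    by move=> CJ x [Ix|Jx]; [left|right; exists J].
  split.
  - by left; apply: ideal0.
  - move=> a b Ua Ub; have [[Ia Ib]|[J [CJ Ja Jb]]] := lub a b Ua Ub.
      by left; apply: idealD.
    by apply: (sub J CJ); apply: (idealD (CP J CJ).1).
  - move=> a b Ub; have [[_ Ib]|[J [CJ _ Jb]]] := lub b b Ub Ub.
      by left; apply: idealMl.
    by apply: (sub J CJ); apply: (idealMl (CP J CJ).1).
  - move=> a b Ua; have [[Ia _]|[J [CJ Ja _]]] := lub a a Ua Ua.
      by left; apply: idealMr.
    by apply: (sub J CJ); apply: (idealMr (CP J CJ).1).
set M := I `|` M0 in idM Mf.
have IM : I `<=` M by move=> x; left.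
have M_comm a b : M (a * b - b * a) by apply/IM/I_comm.
have f_span a : ~ M a -> exists r, M (f - r * a).
  move=> Ma; pose J := [set x | exists r, M (x - r * a)].
  have MJ : M `<=` J by move=> x Mx; exists 0; rewrite mul0r subr0.
  have IJ : I `|` J = J by apply/setUidr => x /IM /MJ.
  have Ja : J a by exists 1; rewrite mul1r subrr; apply: ideal0 idM.
  have [//|nJf] := pselect (J f); case: (maxM J); last first.
    by rewrite /P IJ; split=> //; apply: adjoin_ideal.
  split; first by move=> x M0x; apply: MJ; right.
  by move/(_ a Ja) => M0a; apply: Ma; right.
have M1f : M (1 - f ^+ N.+1).
  have [//|/f_span[r Mr]] := pselect (M (1 - f ^+ N.+1)); case: Mf.
  apply: (ideal_mod idM (b := f ^+ N.+2)).
    by rewrite -opprB; apply/(idealN idM)/IM/I_pow.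
  rewrite exprSr exprSr -mulrA; apply: (idealMl idM).
  apply: (ideal_mod idM (b := r * (1 - f ^+ N.+1) * f)).
    by rewrite -mulrBl; apply: idealMr.
  rewrite -mulrA mulrBl mul1r -exprSr; apply: (idealMl idM).
  by rewrite -opprB; apply/(idealN idM)/IM/I_pow.
suff M_inv a : ~ M a -> exists b, M (b * a - 1).
  have M1 : ~ M 1 by move/(idealMl idM f); rewrite mulr1.
  by exists (FieldIdeal idM M1 M_comm M_inv).
move=> /f_span[r Mr]; exists (f ^+ N * r).
rewrite -(subrKA (f ^+ N.+1)) exprSr -mulrA -mulrBr; apply: (idealD idM).
  by apply: (idealMl idM); rewrite -opprB; apply: (idealN idM).
by rewrite -exprSr -opprB; apply: (idealN idM).
Qed.

End Separation.

(** * Identities of trace algebras *)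

Section FreeTraceAlgebraTheory.
Variables (F : fieldType) (X : Type).
Local Notation FXt := (freeTr F X).

Lemma freeTr_ind (P : FXt -> Prop) :
    (forall x, P (fvar F x)) -> P 0 -> P 1 ->
    (forall f g, P f -> P g -> P (f + g)) ->
    (forall f g, P f -> P g -> P (f * g)) ->
    (forall a f, P f -> P (a *: f)) -> (forall f, P f -> P (ftr f)) ->
  forall f, P f.
Proof.
move=> Pvar P0 P1 PD PM PZ Ptr f; case: (piK f) => u ->.
elim: u => [x| | |u Pu v Pv|u Pu v Pv|a u Pu|u Pu]; first exact: Pvar.
- exact: P0.
- exact: P1.
- by rewrite -faddE; apply: PD.
- by rewrite -fmulE; apply: PM.
- by rewrite -fscaleE; apply: PZ.
- by rewrite -ftrE; apply: Ptr.
Qed.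

Variables (A : algType F) (t : trace A).

Lemma teval_morph (phi : {lrmorphism FXt -> FXt}) (rho : X -> A) :
    (forall f, phi (ftr f) = ftr (phi f)) -> forall f,
  teval t rho (phi f) = teval t (fun x => teval t rho (phi (fvar F x))) f.
Proof.
move=> phi_tr; elim/freeTr_ind => [x| | |f g IHf IHg|f g IHf IHg|a f IHf|f IHf].
- by rewrite teval_var.
- by rewrite !rmorph0.
- by rewrite !rmorph1.
- by rewrite !rmorphD /= IHf IHg.
- by rewrite !rmorphM /= IHf IHg.
- by rewrite !linearZ_LR /= IHf.
- by rewrite phi_tr !teval_tr IHf.
Qed.

Lemma teval_subst (sigma : X -> FXt) (rho : X -> A) f :
  teval t rho (teval (free_trace F X) sigma f)
  = teval t (fun x => teval t rho (sigma x)) f.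
Proof.
rewrite teval_morph => [|g]; last exact: (teval_tr (free_trace F X)).
by congr (teval t _ f); apply/funext => x /=; rewrite teval_var.
Qed.

Lemma trId_T_ideal : T_ideal (@trId F X A t).
Proof.
split=> /=.
- by move=> rho; rewrite rmorph0.
- by move=> f g f0 g0 rho; rewrite rmorphD /= f0 g0 addr0.
- by move=> f g g0 rho; rewrite rmorphM /= g0 mulr0.
- by move=> f g f0 rho; rewrite rmorphM /= f0 mul0r.
- by move=> f f0 rho; rewrite teval_tr f0 linear0.
- by move=> phi phi_tr f f0 rho; rewrite teval_morph.
Qed.

End FreeTraceAlgebraTheory.

Section CapelliIdentities.
Variables (F : fieldType) (X : eqType).
Local Notation FXt := (freeTr F X).

Section AlgebraEvaluation.
Variables (A : algType F) (t : trace A).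
Implicit Types (rho : X -> A) (x : X) (f : FXt).

Definition update rho x (v : A) : X -> A := fun z => if z == x then v else rho z.

Lemma teval_monomial_const rho x v w f :
  monomial w f -> x \notin w -> teval t (update rho x v) f = teval t rho f.
Proof.
elim=> {w f} [|y|w w' f g _ IHf _ IHg|w f _ IHf].
- by rewrite !rmorph1.
- by rewrite inE !teval_var /update eq_sym => /negPf->.
- by rewrite mem_cat !rmorphM /= => /norP[/IHf-> /IHg->].
- by rewrite !teval_tr => /IHf->.
Qed.

(** The unique occurrence of x lies in one factor of each product, and the other
    factor does not depend on the value of x. *)
Lemma teval_monomial_linear rho x w f :
    monomial w f -> count_mem x w = 1%N ->
  linear (fun v => teval t (update rho x v) f).
Proof.
elim=> {w f} [|y|w w' f g mf IHf mg IHg|w f _ IHf] //=.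
- rewrite addn0 => /eqP; rewrite eqb1 => /eqP-> a u v.
  by rewrite !teval_var /update eqxx.
- rewrite count_cat => cx a u v; rewrite !rmorphM /=.
  have [xw | xw] := boolP (x \in w).
    have [c1 c0] : count_mem x w = 1%N /\ count_mem x w' = 0%N.
      move: xw cx; rewrite -has_pred1 has_count.
      by case: (count_mem x w) => [|[|k]] // _ [].
    have xw' : x \notin w' by rewrite -has_pred1 has_count c0.
    by rewrite (IHf c1) !(teval_monomial_const _ _ mg xw') mulrDl scalerAl.
  have c1 : count_mem x w' = 1%N.
    by move: xw cx; rewrite -has_pred1 has_count; case: (count_mem x w).
  by rewrite (IHg c1) !(teval_monomial_const _ _ mf xw) mulrDr scalerAr.
- by move=> /IHf lin a u v; rewrite !teval_tr lin linearP.
Qed.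

Lemma teval_multilinear rho x vs f :
    uniq vs -> x \in vs -> multilinear vs f ->
  linear (fun v => teval t (update rho x v) f).
Proof.
move=> vsU xvs [k [a [m [mP ->]]]] b u v.
rewrite !linear_sum /= -big_split; apply: eq_bigr => i _ /=.
have [w mw wvs] := mP i.
have cx : count_mem x w = 1%N by rewrite (permP wvs) count_uniq_mem ?xvs.
by rewrite !linearZ /= (teval_monomial_linear _ mw cx) scalerDr !scalerA mulrC.
Qed.

(** Identifying the variables xs_i and xs_j before the evaluation changes nothing
    when they have the same value, and it kills f. *)
Lemma teval_alternating rho m (xs : m.-tuple X) f (i j : 'I_m) :
    alternating xs f -> i != j -> rho (tnth xs i) = rho (tnth xs j) ->
  teval t rho f = 0.
Proof.
move=> alt_f ij rho_ij.
have <- : teval t rho (teval (free_trace F X)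
    (fun z => fvar F (if z == tnth xs j then tnth xs i else z)) f) = teval t rho f.
  rewrite teval_subst; congr (teval t _ f); apply/funext => z.
  by rewrite teval_var; case: eqP => // ->.
by rewrite alt_f ?rmorph0.
Qed.

End AlgebraEvaluation.

Lemma not_free_relation (A : vectType F) m (v : m.-tuple A) : ~~ free v ->
  exists (k : 'I_m -> F) i, k i != 0 /\ \sum_j k j *: tnth v j = 0.
Proof.
move/freeP => not_free; apply: contrapT => norel; apply: not_free => k k0 i.
apply: contrapT => /eqP ki; apply: norel; exists k, i; split=> //.
by rewrite -[RHS]k0; apply: eq_bigr => j _; rewrite (tnth_nth 0).
Qed.

(** The values v_j of the alternating variables satisfy a relation
    k_1 v_1 + ... + k_m v_m = 0 with some k_i nonzero. Substitute its left-hand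
    side for the i-th variable: by multilinearity and alternation only the term
    of index i remains, so k_i f(v) = 0. *)
Lemma capelli_identity (A : falgType F) (t : trace A) m :
  (\dim {:A} < m)%N -> @capelli F X m `<=` trId t.
Proof.
move=> dimA f [xs [ys [U mult_f alt_f]]] rho.
pose v := [tuple rho (tnth xs j) | j < m].
have [|k [i [ki sum0]]] := @not_free_relation A m v.
  apply: contraL dimA => /eqP dimv; rewrite -leqNgt -(size_tuple v) -dimv.
  exact/dimvS/subvf.
have xi_vs : tnth xs i \in xs ++ ys by rewrite mem_cat mem_tnth.
pose L u := teval t (update rho (tnth xs i) u) f.
have [L' L'E] : {L' : {linear A -> A} | L' =1 L}.
  have L_lin : linear L by exact: teval_multilinear U xi_vs mult_f.
  pose L' : {linear A -> A} := HB.pack L (GRing.isLinear.Build F A A _ L L_lin).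
  by exists L'.
have /eqP : L' (\sum_j k j *: tnth v j) = 0 by rewrite sum0 linear0.
rewrite linear_sum (bigD1 i) //= big1 => [|j ji].
  rewrite addr0 linearZ scaler_eq0 (negPf ki) L'E tnth_mktuple => /eqP <-.
  congr (teval t _ f); apply/funext => z.
  by rewrite /update; case: eqP => // ->.
rewrite linearZ L'E tnth_mktuple /L (teval_alternating t alt_f ji) /=.
  by rewrite scaler0.
by rewrite /update eqxx; case: eqP.
Qed.

End CapelliIdentities.

(** * The q-th power map on fields over F *)

Section FrobeniusFixedPoints.
Variable F : finFieldType.
Let q := #|F|.

Section CommutativeRing.
Variables (R : comNzRingType) (iota : {rmorphism F -> R}).
Implicit Types x y : R.

Lemma exp_cardD x y : (x + y) ^+ q = x ^+ q + y ^+ q.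
Proof.
have [p p_pr charFp] := finPcharP F.
apply: exprDn_pchar; rewrite /q (card_pprimeChar charFp) pnatX.
apply/orP; left; rewrite (pnatE _ p_pr) inE /= p_pr /=.
by rewrite -(rmorph_nat iota) (pcharf0 charFp) rmorph0 eqxx.
Qed.

Lemma exp_cardB x y : (x - y) ^+ q = x ^+ q - y ^+ q.
Proof. by apply: (canRL (addrK _)); rewrite -exp_cardD subrK. Qed.

Lemma exp_card_iota (a : F) : iota a ^+ q = iota a.
Proof. by rewrite -rmorphXn /= expf_card. Qed.

End CommutativeRing.

Section Field.
Variables (K : fieldType) (iota : {rmorphism F -> K}).
Implicit Types g h x : K.

(** X^q - X is the product of the X - a for a in F, so it has no further root
    in K. *)
Lemma exp_card_fixed x : x ^+ q = x -> exists a, x = iota a.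
Proof.
move=> xq; have : root (map_poly iota ('X^q - 'X)) x.
  by rewrite rmorphB /= map_polyXn map_polyX rootE !hornerE xq subrr.
rewrite finField_genPoly rmorph_prod /= -big_enum /=.
under eq_bigr do rewrite map_polyXsubC.
by rewrite -(big_map iota xpredT (fun z => 'X - z%:P)) root_prod_XsubC
  => /mapP[a _ ->]; exists a.
Qed.

(** If h = a + b g with a and b fixed by the q-th power, then
    h^q = a + b g^q. So b has to be (h - h^q) / (g - g^q), which is indeed
    fixed since g and g^q, and h and h^q, are swapped; then so is h - b g. *)
Lemma quadratic_span g h : g ^+ q != g -> g ^+ (q ^ 2) = g ->
  h ^+ (q ^ 2) = h -> exists a b, h = iota a + iota b * g.
Proof.
rewrite -mulnn !exprM => gq gqq hqq.
have dg : g - g ^+ q != 0 by rewrite subr_eq0 eq_sym.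
have [|b Db] := @exp_card_fixed ((h - h ^+ q) / (g - g ^+ q)).
  rewrite exprMn exprVn !(exp_cardB iota) gqq hqq -[h ^+ q - h]opprB.
  by rewrite -[g ^+ q - g]opprB invrN mulrNN.
have Dh : h - h ^+ q = iota b * (g - g ^+ q) by rewrite -Db divfK.
have [|a Da] := @exp_card_fixed (h - iota b * g).
  rewrite (exp_cardB iota) exprMn exp_card_iota.
  have -> : h ^+ q = h - iota b * (g - g ^+ q) by rewrite -Dh; ring.
  by ring.
by exists a, b; rewrite -Da subrK.
Qed.

Lemma quadratic_free g a b :
  g ^+ q != g -> iota a + iota b * g = 0 -> a = 0 /\ b = 0.
Proof.
move=> gq ab0; have [b0|b0] := eqVneq b 0.
  by move/eqP: ab0; rewrite b0 rmorph0 mul0r addr0 fmorph_eq0 => /eqP.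
case/eqP: gq; have -> : g = iota (- a / b).
  rewrite fmorph_div rmorphN; apply: (canRL (mulfK _)); first by rewrite fmorph_eq0.
  by apply/eqP; rewrite mulrC -addr_eq0 addrC ab0.
exact: exp_card_iota.
Qed.

End Field.

Section QuadraticExtension.
Variables (E : fieldExtType F).
Hypothesis dimE : \dim {:E} = 2%N.
Implicit Types x : E.

Lemma exp_card2 x : x ^+ (q ^ 2) = x.
Proof.
have := memvf x; rewrite (Fermat's_little_theorem {:E}%AS) /= dimE.
by move/eqP.
Qed.

Lemma galois_group_quadratic :
  {alpha : gal_of {:finvect_type E} | #[alpha]%g = 2%N /\
    'Gal({:finvect_type E} / 1)%g = <[alpha]>%g & forall x, alpha x = x ^+ q}.
Proof.
have [alpha gen_alpha Dalpha] := finField_galois_generator (sub1v {:finvect_type E}).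
have cardG : #|'Gal({:finvect_type E} / 1)%g| = 2%N.
  rewrite -galois_dim ?finField_galois ?sub1v // dimv1 divn1 -dimE.
  by rewrite !dimvf.
have o_alpha : #[alpha]%g = 2%N by rewrite orderE -(eqP gen_alpha).
exists alpha => [|x]; last by rewrite Dalpha ?memvf // dimv1 expn1.
by split=> //; apply/eqP.
Qed.

Lemma field_trE x : field_tr x = x + x ^+ q.
Proof.
have [alpha [o_alpha defG] Dalpha] := galois_group_quadratic.
rewrite /field_tr /galTrace defG cycle2g // big_setU1 ?inE /=.
  by rewrite big_set1 gal_id Dalpha.
by rewrite eq_sym -order_gt1 o_alpha.
Qed.

Lemma field_normE x : field_norm x = x * x ^+ q.
Proof.
have [alpha [o_alpha defG] Dalpha] := galois_group_quadratic.
rewrite /field_norm /galNorm defG cycle2g // big_setU1 ?inE /=.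
  by rewrite big_set1 gal_id Dalpha.
by rewrite eq_sym -order_gt1 o_alpha.
Qed.

End QuadraticExtension.
End FrobeniusFixedPoints.

(** * The trace identities of a quadratic extension *)

Section Soundness.
Variables (F : finFieldType) (E : fieldExtType F).
Hypothesis dimE : \dim {:E} = 2%N.
Variables (c : E) (s n : F).
Hypotheses (sE : s%:A = field_tr c) (nE : n%:A = field_norm c).
Let q := #|F|.
Implicit Types u v : E.

Lemma TrcE u : Trc c u = c * u + c ^+ q * u ^+ q.
Proof. by rewrite /Trc field_trE // exprMn. Qed.

Lemma Trc1 : Trc c 1 = s%:A.
Proof. by rewrite sE /Trc mulr1. Qed.

(** With U = u^q and V = v^q, both sides of
    Tr(u) Tr(v) - s Tr(u v) = - n (u - U) (v - V) expand to
    c C (u V + U v - u v - U V). *)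
Lemma Trc_product u v :
  Trc c u * Trc c v - s *: Trc c (u * v) + n *: ((u - u ^+ q) * (v - v ^+ q)) = 0.
Proof.
rewrite -(mulr_algl s) -(mulr_algl n) sE nE field_trE // field_normE // !TrcE.
by rewrite exprMn -/q; ring.
Qed.

Lemma Trc_exp_card u : Trc c u ^+ q = Trc c u.
Proof.
rewrite TrcE (exp_cardD (in_alg E)) !exprMn -!exprM mulnn !exp_card2 //.
by rewrite addrC.
Qed.

Lemma Trc_support u : Trc c u * (1 - u ^+ (q ^ 2 - 1)) = 0.
Proof.
have [->|u0] := eqVneq u 0; first by rewrite linear0 mul0r.
suff -> : u ^+ (q ^ 2 - 1) = 1 by rewrite subrr mulr0.
apply: (mulIf u0); rewrite mul1r -exprSr subn1 prednK ?exp_card2 //.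
by rewrite expn_gt0 (ltnW (finNzRing_gt1 F)).
Qed.

End Soundness.

(** * Comparing a quotient of the free trace algebra with E *)

(** The embedding of the image of pi into A is handled as a relation: an element
    of K and an element of A correspond when they have the same coordinates in F,
    on 1 and g in K and on 1 and e in A. When g and e satisfy the same quadratic
    equation and have the same trace, the relation is compatible with all
    the operations, whether or not 1 and g are independent. *)
Section PairEvaluation.
Variables (F : fieldType) (X : Type) (A : comAlgType F) (t : trace A).
Local Notation FXt := (freeTr F X).
Variables (K : comNzRingType) (pi : {rmorphism FXt -> K}).
Hypothesis pi_tr : forall h, pi h = 0 -> pi (ftr h) = 0.
Variables (iota : {rmorphism F -> K}) (j : {rmorphism F -> A}).
Hypotheses (iotaE : forall a, pi a%:A = iota a) (jE : forall a, j a = a%:A).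

Variables (g : FXt) (e : A) (al be s tau : F).
Hypotheses (g2 : pi g ^+ 2 = iota al * pi g - iota be).
Hypotheses (e2 : e ^+ 2 = j al * e - j be).
Hypotheses (tr1g : pi (ftr 1) = iota s) (tr1e : t 1 = j s).
Hypotheses (trg : pi (ftr g) = iota tau) (tre : t e = j tau).

Definition same_coords (k : K) (z : A) : Prop :=
  exists a b, k = iota a + iota b * pi g /\ z = j a + j b * e.

Lemma pair_evaluation :
    (forall x, exists a b, pi (fvar F x) = iota a + iota b * pi g) ->
  exists rho : X -> A, forall h, same_coords (pi h) (teval t rho h).
Proof.
move=> span.
have [|ab abP] := @choice X (F * F)%type
    (fun x ab => pi (fvar F x) = iota ab.1 + iota ab.2 * pi g).
  by move=> x; have [a [b Dx]] := span x; exists (a, b).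
exists (fun x => j (ab x).1 + j (ab x).2 * e).
elim/freeTr_ind => [x| | |f h [a [b [Df De]]] [a' [b' [Df' De']]]
  |f h [a [b [Df De]]] [a' [b' [Df' De']]]|d f [a [b [Df De]]]|f [a [b [Df De]]]].
- by exists (ab x).1, (ab x).2; rewrite teval_var abP.
- by exists 0, 0; rewrite !rmorph0 !mul0r !addr0.
- by exists 1, 0; rewrite !rmorph1 !rmorph0 !mul0r !addr0.
- exists (a + a'), (b + b'); rewrite !rmorphD /=.
  by split; [rewrite Df Df' | rewrite De De']; ring.
- exists (a * a' - b * b' * be), (a * b' + b * a' + b * b' * al).
  rewrite !(rmorphM, rmorphB, rmorphD) /=; split.
    rewrite Df Df'.
    transitivity (iota a * iota a' + (iota a * iota b' + iota b * iota a') * pi g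
      + iota b * iota b' * pi g ^+ 2); first by ring.
    by rewrite g2; ring.
  rewrite De De'.
  transitivity (j a * j a' + (j a * j b' + j b * j a') * e
    + j b * j b' * e ^+ 2); first by ring.
  by rewrite e2; ring.
- exists (d * a), (d * b).
  rewrite linearZ /= -mulr_algl -[d *: teval _ _ _]mulr_algl -jE.
  by rewrite !rmorphM /= iotaE; split; [rewrite Df | rewrite De]; ring.
- exists (a * s + b * tau), 0.
  rewrite teval_tr De !rmorphD !rmorphM !rmorph0 !mul0r !addr0 /=.
  split; last first.
    by rewrite [j a]jE [j b]jE !mulr_algl linearD !linearZ /= tr1e tre.
  have /pi_tr/eqP : pi (f - (a%:A + b *: g)) = 0.
    by rewrite -(mulr_algl b g) !(rmorphB, rmorphD, rmorphM) /= !iotaE Df subrr.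
  rewrite linearB rmorphB subr_eq0 => /eqP ->.
  rewrite linearD !linearZ /= -(mulr_algl a) -(mulr_algl b) !(rmorphD, rmorphM) /= !iotaE.
  by rewrite tr1g trg.
Qed.

End PairEvaluation.

Section Transfer.
Variables (F : finFieldType) (E : fieldExtType F).
Hypothesis dimE : \dim {:E} = 2%N.
Let q := #|F|.
Local Notation j := (in_alg E).

(** The polynomial P = X^2 - al X + be has the roots g and g^q in K, both of
    which are roots of X^(q^2) - X; so P divides X^(q^2) - X over F, and the
    latter splits in E. A root e of P in E cannot be a scalar a, since a would
    then be g or g^q in K. Hence e and e^q are the two roots of P. *)
Lemma conjugates_in_extension (K : fieldType) (iota : {rmorphism F -> K}) g al be :
    g ^+ q != g -> g ^+ (q ^ 2) = g ->
    g + g ^+ q = iota al -> g * g ^+ q = iota be ->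
  exists e : E, [/\ e ^+ q != e, e + e ^+ q = j al & e * e ^+ q = j be].
Proof.
move=> gq gqq sum_g mul_g.
pose P : {poly F} := 'X^2 - al *: 'X + be%:P.
have P_K : map_poly iota P = ('X - g%:P) * ('X - (g ^+ q)%:P).
  rewrite !(rmorphB, rmorphD) /= map_polyXn map_polyZ map_polyX map_polyC /=.
  by rewrite -sum_g -mul_g -mul_polyC !(polyCD, polyCM); ring.
have P_dvd : P %| 'X^(q ^ 2) - 'X.
  rewrite -(dvdp_map iota) P_K rmorphB /= map_polyXn map_polyX.
  have := @uniq_roots_dvdp K ('X^(q ^ 2) - 'X) [:: g; g ^+ q].
  rewrite big_cons big_seq1; apply.
    rewrite /= !rootE !hornerE gqq subrr eqxx /= andbT.
    by rewrite exprAC gqq subrr eqxx.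
  by rewrite uniq_rootsE /= inE eq_sym gq.
have size_P : size P = 3%N.
  rewrite -(size_map_poly iota) P_K size_Mmonic ?monicXsubC ?polyXsubC_eq0 //.
  by rewrite !size_XsubC.
have [e Pe] : exists e : E, root (map_poly j P) e.
  have genE : 'X^(q ^ 2) - 'X
      = \prod_(z <- enum (finvect_type E)) ('X - z%:P) :> {poly E}.
    rewrite big_enum /= -(finField_genPoly (finvect_type E)).
    by rewrite -[2%N]dimE -(card_vspace {:finvect_type E}) card_vspacef.
  have : map_poly j P %| 'X^(q ^ 2) - 'X.
    by move: P_dvd; rewrite -(dvdp_map j) rmorphB /= map_polyXn map_polyX.
  rewrite genE => /dvdp_prod_XsubC[m Pm].
  case Dm: (mask m _) Pm => [|e r] Pm.
    by move/eqp_size: Pm; rewrite big_nil size_map_poly size_P size_poly1.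
  by exists e; rewrite (eqp_root Pm) root_prod_XsubC inE eqxx.
have {Pe} e2 : e ^+ 2 = j al * e - j be.
  move: Pe; rewrite rootE !(rmorphB, rmorphD) /= map_polyXn map_polyZ map_polyX.
  rewrite map_polyC !hornerE /= => /eqP Pe.
  by apply/eqP; rewrite -subr_eq0 opprB addrA addrAC -Pe; apply/eqP; ring.
have eq_e : e ^+ q != e.
  apply: contraNneq gq => /(@exp_card_fixed F E j)[a /= Da].
  have : (iota a - g) * (iota a - g ^+ q) = 0.
    transitivity (iota (a ^+ 2 - al * a + be)).
      by rewrite !(rmorphB, rmorphD, rmorphM, rmorphXn) /= -sum_g -mul_g; ring.
    suff -> : a ^+ 2 - al * a + be = 0 by rewrite rmorph0.
    apply: (fmorph_inj j); rewrite rmorph0 !(rmorphB, rmorphD, rmorphM, rmorphXn) /=.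
    by rewrite -Da -expr2 e2 /=; ring.
  move/eqP; rewrite mulf_eq0 !subr_eq0 => /orP[/eqP <-|/eqP ga].
    exact/eqP/exp_card_iota.
  by rewrite -[X in _ == X]gqq -mulnn exprM -ga exp_card_iota.
have eq2 : (e ^+ q) ^+ 2 = j al * e ^+ q - j be.
  by rewrite exprAC e2 (exp_cardB j) exprMn !exp_card_iota.
have sum_e : e + e ^+ q = j al.
  apply/eqP; rewrite -subr_eq0; apply/eqP.
  apply: (@mulfI _ (e - e ^+ q)); first by rewrite subr_eq0 eq_sym.
  rewrite mulr0; transitivity
    (e ^+ 2 - (e ^+ q) ^+ 2 - (e - e ^+ q) * j al); first by ring.
  by rewrite e2 eq2; ring.
exists e; split=> //.
have -> : e ^+ q = j al - e by rewrite -sum_e; ring.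
by rewrite mulrBr -expr2 e2; ring.
Qed.

Variables (c : E) (s n : F).
Hypotheses (sE : s%:A = field_tr c) (nE : n%:A = field_norm c).

(** The polynomial equation assumed for tau is the one satisfied by Tr(e) and
    Tr(e^q): their sum is s al, and their product is
    s^2 be + n (al^2 - 4 be) by [Trc_product] at (e, e^q), because
    (e - e^q)^2 = al^2 - 4 be. *)
Lemma traced_conjugate (e : E) al be tau :
    e ^+ q != e -> e + e ^+ q = j al -> e * e ^+ q = j be ->
    tau ^+ 2 - s * al * tau + s ^+ 2 * be + n * (al ^+ 2 - 4%:R * be) = 0 ->
  exists e', [/\ e' ^+ q != e', e' + e' ^+ q = j al, e' * e' ^+ q = j be
    & Trc c e' = j tau].
Proof.
move=> eq_e sum_e mul_e Dtau.
have eqq : (e ^+ q) ^+ q = e by rewrite -exprM mulnn exp_card2.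
have Trc_in a : Trc c (j a) = j s * j a.
  by rewrite /= linearZ /= (Trc1 sE) mulr_algl !scalerA mulrC.
have sum_tr : Trc c e + Trc c (e ^+ q) = j s * j al.
  by rewrite -linearD sum_e; apply: Trc_in.
have mul_tr : Trc c e * Trc c (e ^+ q)
    = j s * (j s * j be) + j n * (e - e ^+ q) ^+ 2.
  have := Trc_product dimE sE nE e (e ^+ q).
  rewrite -/q eqq mul_e Trc_in -(mulr_algl s) -(mulr_algl n) => D.
  by apply/eqP; rewrite -subr_eq0 -D; apply/eqP; rewrite /=; ring.
have : (j tau - Trc c e) * (j tau - Trc c (e ^+ q)) = 0.
  transitivity (j (tau ^+ 2 - s * al * tau + s ^+ 2 * be
    + n * (al ^+ 2 - 4%:R * be))); last by rewrite Dtau rmorph0.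
  transitivity (j tau ^+ 2 - (Trc c e + Trc c (e ^+ q)) * j tau
    + Trc c e * Trc c (e ^+ q)); first by ring.
  rewrite sum_tr mul_tr !(rmorphB, rmorphD, rmorphM, rmorphXn, rmorph_nat).
  by rewrite /= -[al%:A]sum_e -[be%:A]mul_e; ring.
move/eqP; rewrite mulf_eq0 !subr_eq0 => /orP[]/eqP Dt; first by exists e.
by exists (e ^+ q); rewrite eqq addrC mulrC eq_sym.
Qed.

End Transfer.

(** * Commutativity from the Capelli polynomials *)

Section StandardPolynomial.

Definition std3 (R : pzRingType) (a b d : R) : R :=
  a * b * d - b * a * d + b * d * a - d * b * a + d * a * b - a * d * b.

Lemma rmorph_std3 (R S : pzRingType) (phi : {rmorphism R -> S}) a b d :
  phi (std3 a b d) = std3 (phi a) (phi b) (phi d).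
Proof. by rewrite !(rmorphB, rmorphD, rmorphM). Qed.

Lemma std3_1l (R : pzRingType) (a b : R) : std3 1 a b = a * b - b * a.
Proof. by rewrite /std3 !mul1r !mulr1 subrr add0r subrK. Qed.

Lemma std3_repeat (R : pzRingType) (a b d : R) :
  a = b \/ b = d \/ a = d -> std3 a b d = 0.
Proof.
rewrite /std3 => -[->|[->|->]].
- by rewrite subrr add0r subrK subrr.
- by rewrite addrK subrK subrr.
- by rewrite subrK subrr add0r subrr.
Qed.

Lemma std3_capelli (F : fieldType) (X : eqType) (x y z : X) :
  uniq [:: x; y; z] -> capelli 3 (std3 (fvar F x) (fvar F y) (fvar F z)).
Proof.
move=> U; exists [tuple x; y; z], [::]; split=> //.
  set fx := fvar F x; set fy := fvar F y; set fz := fvar F z.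
  exists 6, (fun i => [:: 1; -1; 1; -1; 1; -1]`_i).
  exists (fun i => [:: fx * fy * fz; fy * fx * fz; fy * fz * fx; fz * fy * fx;
                       fz * fx * fy; fx * fz * fy]`_i).
  split; last first.
    by rewrite !big_ord_recl big_ord0 /= !scaleN1r !scale1r addr0 !addrA.
  have mon3 u v w : perm_eq [:: u; v; w] [:: x; y; z] ->
    exists2 t, monomial t (fvar F u * fvar F v * fvar F w) & perm_eq t [:: x; y; z].
    move=> uvw; exists ([:: u] ++ [:: v] ++ [:: w]) => //.
    by rewrite catA; do !apply: monomialM; apply: monomial_var.
  by case=> [[|[|[|[|[|[|//]]]]]] ?]; apply: mon3; apply/permP => p /=; ring.
move=> i j ij; set sigma := fun v : X => _.
have sigma_ij : sigma (tnth [tuple x; y; z] i) = sigma (tnth [tuple x; y; z] j).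
  by rewrite /sigma eqxx; case: eqP.
rewrite rmorph_std3 /= !teval_var std3_repeat //; move: sigma sigma_ij => sigma.
case: i j ij => [[|[|[|//]]] ?] [[|[|[|//]]] ?] //= _;
  rewrite !(tnth_nth x) /= => ->; tauto.
Qed.

Lemma third_variable (X : eqType) (x y : X) :
  infinite_set [set: X] -> exists z, (z != x) && (z != y).
Proof.
move=> X_inf; apply: contrapT => noz; apply: X_inf.
apply: (@sub_finite_set _ _ [set x; y]); last exact: finite_set2.
move=> z _ /=; apply: contrapT => /not_orP[/eqP zx /eqP zy].
by apply: noz; exists z; rewrite zx.
Qed.

End StandardPolynomial.

Section Substitution.
Variables (F : fieldType) (X : eqType).
Local Notation FXt := (freeTr F X).
Variable I : set FXt.
Hypothesis TI : T_ideal I.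

Lemma T_ideal_two_sided : two_sided_ideal I.
Proof. by case: TI. Qed.

Lemma T_ideal_subst (sigma : X -> FXt) f :
  I f -> I (teval (free_trace F X) sigma f).
Proof. by apply: (T_ideal_endo TI) => g; apply: (teval_tr (free_trace F X)). Qed.

Lemma T_ideal_commutator (x y z : X) (u v : FXt) :
  uniq [:: x; y; z] -> @capelli F X 3 `<=` I -> I (u * v - v * u).
Proof.
move=> U capI; pose sigma w : FXt := if w == x then 1 else if w == y then u else v.
have := T_ideal_subst sigma (capI _ (std3_capelli F U)).
move: U; rewrite /= !inE negb_or !andbT => /andP[/andP[xy xz] yz].
rewrite rmorph_std3 /= !teval_var /sigma eqxx eq_sym (negPf xy) eqxx.
by rewrite eq_sym (negPf xz) eq_sym (negPf yz) std3_1l.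
Qed.

Lemma T_ideal_specialize (u : FXt) :
  exists phi : {lrmorphism FXt -> FXt},
    [/\ forall f, phi (ftr f) = ftr (phi f), forall x, phi (fvar F x) = u
      & forall f, I f -> I (phi f)].
Proof.
exists (teval (free_trace F X) (fun=> u)); split=> [f|x|f].
- exact: (teval_tr (free_trace F X)).
- exact: teval_var.
- exact: T_ideal_subst.
Qed.

End Substitution.

(** * Every identity follows from the generators *)

Section Completeness.
Variables (F : finFieldType) (E : fieldExtType F).
Hypothesis dimE : \dim {:E} = 2%N.
Variables (c : E) (s n : F).
Hypotheses (sE : s%:A = field_tr c) (nE : n%:A = field_norm c).
Let q := #|F|.
Variable X : Type.
Local Notation FXt := (freeTr F X).
Variable I : set FXt.
Hypotheses (idI : two_sided_ideal I) (I_comm : forall u v, I (u * v - v * u)).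
Hypotheses
  (I_prod : forall u, I (ftr u * ftr u - s *: ftr (u * u)
                         + n *: ((u - u ^+ q) * (u - u ^+ q))))
  (I_tr1 : I (ftr 1 - s%:A))
  (I_trq : forall u, I (ftr u ^+ q - ftr u))
  (I_supp : forall u, I (ftr u * (1 - u ^+ (q ^ 2 - 1))))
  (I_exp : forall u, I (u ^+ (q ^ 2) - u)).

Lemma sqr_card_gt1 : (1 < q ^ 2)%N.
Proof. by rewrite (ltn_exp2l 0) ?finNzRing_gt1. Qed.

(** The support identity makes the kernel of pi stable under t, so the image of pi
    is a trace algebra. It consists of fixed points of the q^2-th power, hence
    is F or F + F g, and in either case it embeds in (E, Tr). *)
Lemma field_quotient_vanish (K : fieldType) (pi : {rmorphism FXt -> K}) f :
  (forall u, I u -> pi u = 0) -> trId (Trc_trace c) f -> pi f = 0.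
Proof.
move=> pi_I id_f.
have [iota iotaE] : {iota : {rmorphism F -> K} | forall a, pi a%:A = iota a}.
  pose iota : {rmorphism F -> K} := pi \o in_alg FXt.
  by exists iota.
have piZ a h : pi (a *: h) = iota a * pi h by rewrite -mulr_algl rmorphM /= iotaE.
have pi_tr h : pi h = 0 -> pi (ftr h) = 0.
  move=> h0; have := pi_I _ (I_supp h).
  rewrite rmorphM rmorphB rmorph1 rmorphXn /= h0 expr0n subn_eq0.
  by rewrite leqNgt sqr_card_gt1 subr0 mulr1.
have pi_tr1 : pi (ftr 1) = iota s.
  by apply/eqP; rewrite -subr_eq0 -iotaE -rmorphB; apply/eqP/pi_I.
have pi_exp u : pi u ^+ (q ^ 2) = pi u.
  by apply/eqP; rewrite -subr_eq0 -rmorphXn -rmorphB; apply/eqP/pi_I.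
(* Both cases below produce g and e with the same quadratic equation and the same
   trace. The last premise carries the vanishing of f from E back to K: an element
   of K is zero as soon as the element of E with the same coordinates is. *)
have conclude (g : FXt) (e : E) al be tau :
    pi g ^+ 2 = iota al * pi g - iota be ->
    e ^+ 2 = in_alg E al * e - in_alg E be ->
    pi (ftr g) = iota tau -> Trc c e = in_alg E tau ->
    (forall x, exists a b, pi (fvar F x) = iota a + iota b * pi g) ->
    (forall a b, in_alg E a + in_alg E b * e = 0 -> iota a + iota b * pi g = 0) ->
  pi f = 0.
  move=> g2 e2 trg tre span indep.
  have [rho rhoP] := @pair_evaluation F X E (Trc_trace c) K pi pi_tr iota (in_alg E)
    iotaE (fun _ => erefl) g e al be s tau g2 e2 pi_tr1 (Trc1 sE) trg tre span.
  have [a [b [-> De]]] := rhoP f.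
  by apply: indep; rewrite -De; apply: id_f.
have [[g0 g0q]|fixed] := pselect (exists g0, pi g0 ^+ q != pi g0); last first.
  have {}fixed u : exists a, pi u = iota a.
    apply: exp_card_fixed; apply/eqP; apply: contrapT => /negP piu.
    by apply: fixed; exists u.
  (* The image of pi is F: take g = e = 0, which leaves the coordinate on 1. *)
  apply: (conclude 0 0 0 0 0).
  - by rewrite !rmorph0 !mul0r expr0n subrr.
  - by rewrite !rmorph0 !mul0r expr0n subrr.
  - by rewrite linear0 !rmorph0.
  - by rewrite linear0 !rmorph0.
  - by move=> x; have [a ->] := fixed (fvar F x); exists a, 0;
      rewrite rmorph0 mul0r addr0.
  - move=> a b; rewrite rmorph0 !mulr0 !addr0 => /eqP.
    by rewrite fmorph_eq0 => /eqP->; rewrite rmorph0.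
pose g := pi g0.
have gqq : (g ^+ q) ^+ q = g by rewrite -exprM mulnn pi_exp.
have [al sum_g] : exists al, g + g ^+ q = iota al.
  by apply: exp_card_fixed; rewrite (exp_cardD iota) gqq addrC.
have [be mul_g] : exists be, g * g ^+ q = iota be.
  by apply: exp_card_fixed; rewrite exprMn gqq mulrC.
have g2 : g ^+ 2 = iota al * g - iota be by rewrite -sum_g -mul_g; ring.
have [tau trg] : exists tau, pi (ftr g0) = iota tau.
  apply: exp_card_fixed; apply/eqP; rewrite -subr_eq0 -rmorphXn -rmorphB.
  by apply/eqP/pi_I.
have [e0 [e0q sum_e0 mul_e0]] :=
  conjugates_in_extension dimE g0q (pi_exp g0) sum_g mul_g.
(* The first generator at x = y = g0, read in F. *)
have Dtau : tau ^+ 2 - s * al * tau + s ^+ 2 * be + n * (al ^+ 2 - 4%:R * be) = 0.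
  apply: (fmorph_inj iota); rewrite rmorph0.
  have tr_g2 : pi (ftr (g0 * g0)) = iota al * iota tau - iota be * iota s.
    have /pi_tr/eqP : pi (g0 * g0 - (al *: g0 - be%:A)) = 0.
      by rewrite !rmorphB rmorphM /= piZ iotaE -expr2 -g2 subrr.
    rewrite linearB rmorphB subr_eq0 => /eqP ->.
    rewrite linearB /= [ftr (al *: _)]linearZ [ftr be%:A]linearZ rmorphB /= !piZ.
    by rewrite trg pi_tr1.
  have D := pi_I _ (I_prod g0).
  rewrite !(rmorphB, rmorphD, piZ, rmorphM, rmorphXn) /= trg tr_g2 -/g in D.
  rewrite !(rmorphB, rmorphD, rmorphM, rmorphXn, rmorph_nat) -D -sum_g -mul_g.
  by rewrite /=; ring.
have [e [eq sum_e mul_e tre]] := traced_conjugate dimE sE nE e0q sum_e0 mul_e0 Dtau.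
apply: (conclude g0 e al be tau) => //.
- by rewrite -sum_e -mul_e; ring.
- by move=> x; apply: quadratic_span.
- move=> a b /(quadratic_free eq)[-> ->].
  by rewrite rmorph0 mul0r addr0.
Qed.

Lemma trId_sub_ideal : trId (Trc_trace c) `<=` I.
Proof.
move=> f id_f; apply: contrapT => If.
have I_pow u : I (u ^+ (q ^ 2).-2.+2 - u).
  by case: (q ^ 2)%N sqr_card_gt1 (I_exp u) => [|[|]].
have [M IM Mf] := separating_field_ideal idI I_comm I_pow If.
apply: Mf; apply/residue_map_eq0.
apply: field_quotient_vanish id_f => u Iu.
by apply/residue_map_eq0/IM.
Qed.

End Completeness.

Theorem theorem22 (F : finFieldType) (E : fieldExtType F)
    (dimE : \dim {:E} = 2%N) (c : E) (c_neq0 : c != 0)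
    (s : F) (sE : s%:A = field_tr c) (n : F) (nE : n%:A = field_norm c)
    (X : eqType) (X_inf : infinite_set [set: X])
    (vx vy : X) (vx_neq_vy : vx != vy) :
  let q := #|F| in
  let x : freeTr F X := fvar F vx in
  let y : freeTr F X := fvar F vy in
  trId (Trc_trace c) =
  T_ideal_gen
    ([set ftr x * ftr y - s *: ftr (x * y) + n *: ((x - x ^+ q) * (y - y ^+ q));
          ftr 1 - s%:A;
          ftr x ^+ q - ftr x;
          ftr x * (1 - x ^+ (q ^ 2 - 1));
          x ^+ (q ^ 2) - x]
     `|` @capelli F X 3).
Proof.
move=> q x y; apply/seteqP; split; last first.
  apply: smallest_sub; first exact: trId_T_ideal.
  move=> f []; last by apply: capelli_identity; rewrite dimE.
  case=> [[[[->|->]|->]|->]|->] rho.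
  - rewrite linearD linearB !linearZ /= !(rmorphM, rmorphB, rmorphXn) /= !teval_tr.
    by rewrite rmorphM /= !teval_var scalerN (Trc_product dimE sE nE).
  - by rewrite linearB linearZ /= teval_tr !rmorph1 /= (Trc1 sE) subrr.
  - by rewrite rmorphB rmorphXn /= teval_tr /= (Trc_exp_card dimE) subrr.
  - by rewrite rmorphM rmorphB rmorph1 rmorphXn /= teval_tr (Trc_support dimE).
  - by rewrite rmorphB rmorphXn /= (exp_card2 dimE) subrr.
move=> f id_f I [TI SI].
have specialize u := T_ideal_specialize TI u.
have capI : @capelli F X 3 `<=` I by move=> g cg; apply: SI; right.
have [z /andP[zx zy]] := third_variable vx vy X_inf.
have U : uniq [:: vx; vy; z].
  by rewrite /= !inE negb_or vx_neq_vy !(eq_sym _ z) zx zy.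
apply: (trId_sub_ideal dimE sE nE _ _ _ _ _ _ _ id_f).
- exact: T_ideal_two_sided.
- by move=> u v; apply: T_ideal_commutator U capI.
- move=> u; have [ev [ev_tr ev_var evI]] := specialize u.
  have /evI := SI _ (or_introl (or_introl (or_introl (or_introl (or_introl erefl))))).
  rewrite linearD linearB !linearZ /= !(rmorphM, rmorphB, rmorphXn) /= !ev_tr.
  by rewrite rmorphM /= !ev_var scalerN.
- exact: SI _ (or_introl (or_introl (or_introl (or_introl (or_intror erefl))))).
- move=> u; have [ev [ev_tr ev_var evI]] := specialize u.
  have /evI := SI _ (or_introl (or_introl (or_introl (or_intror erefl)))).
  by rewrite rmorphB rmorphXn /= !ev_tr !ev_var.
- move=> u; have [ev [ev_tr ev_var evI]] := specialize u.
  have /evI := SI _ (or_introl (or_introl (or_intror erefl))).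
  by rewrite rmorphM rmorphB rmorph1 rmorphXn /= !ev_tr !ev_var.
- move=> u; have [ev [ev_tr ev_var evI]] := specialize u.
  have /evI := SI _ (or_introl (or_intror erefl)).
  by rewrite rmorphB rmorphXn /= !ev_var.
Qed.
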